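(* Let $G=(V,E)$ be a directed acyclic graph with $V=\{1,\dots,m\}$. If the model $\mathcal{N}_*(G)$ is generically finitely identifiable, then both of the following conditions hold: (i) $|E_{con}|-|E|\ge d_{con}$, where $d_{con}$ is the number of connected components of the complement graph $(G_{con})^c$ that do not contain any odd cycle; (ii) $|E_{|L,cov}|-|E|\ge d_{cov}$, where $d_{cov}$ is the number of connected components of the complement graph $(G_{|L,cov})^c$ that do not contain any odd cycle.
   Context: Let $G=(V,E)$ be a directed acyclic graph (DAG) with $V=\{1,\dots,m\}$, labelled in topological order, i.e. $w\to v\in E$ only if $w<v$. Let $\mathbb{R}_E=\{\Lambda=(\lambda_{wv})\in\mathbb{R}^{m\times m}: w\to v\notin E\Rightarrow \lambda_{wv}=0\}$, let $\mathrm{diag}_m^+$ be the set of $m\times m$ diagonal matrices with positive diagonal, and let $\Theta=\mathbb{R}_E\times \mathrm{diag}_m^+\times\mathbb{R}^m$, regarded as an open subset of $\mathbb{R}^{2m+|E|}$. The model $\mathcal{N}_*(G)$ is the family of normal distributions $N_m(0,\Sigma)$ with $\Sigma$ in the image of $$\phi_G:\Theta\to\mathbb{R}^{m\times m},\qquad \phi_G(\Lambda,\Omega,\delta)=(I_m-\Lambda^T)^{-1}(\Omega+\delta\delta^T)(I_m-\Lambda)^{-1}.$$ An algebraic set in $\mathbb{R}^n$ is the common zero set of finitely many real polynomials; it is proper if it is not all of $\mathbb{R}^n$. A map $f$ defined on an open set $S\subset\mathbb{R}^n$ is generically finite-to-one if there is a proper algebraic set $\tilde S\subset\mathbb{R}^n$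 such that for every $s\in S\setminus\tilde S$ the fiber $\{s'\in S: f(s')=f(s)\}$ is finite. The model $\mathcal{N}_*(G)$ is generically finitely identifiable if $\phi_G$ is generically finite-to-one on $\Theta$. For $(\Lambda,\Omega)\in\mathbb{R}_E\times\mathrm{diag}_m^+$ put $\Sigma_{|L}=(I_m-\Lambda^T)^{-1}\Omega(I_m-\Lambda)^{-1}$. Define undirected graphs $G_{|L,cov}=(V,E_{|L,cov})$ and $G_{con}=(V,E_{con})$ by: for distinct $v,w\in V$, the edge $v\text{ --- }w$ is in $E_{|L,cov}$ iff $(\Sigma_{|L})_{vw}$ is not identically zero as a function of $(\Lambda,\Omega)$, and $v\text{ --- }w$ is in $E_{con}$ iff $(\Sigma_{|L}^{-1})_{vw}$ is not identically zero as a function of $(\Lambda,\Omega)$. For an undirected graph $H=(V,F)$, its complement $H^c$ is the undirected graph on $V$ whose edges are the pairs of distinct nodes not adjacent in $H$. Isolated nodes count as connected components (containing no odd cycle). *)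

(* Defs.v *)
From HB Require Import structures.
From mathcomp Require Import all_boot all_order all_algebra.
From mathcomp Require Import boolp classical_sets cardinality reals.
From mathcomp Require Import mpoly.

Set Implicit Arguments.
Unset Strict Implicit.
Unset Printing Implicit Defensive.

Import Order.TTheory GRing.Theory Num.Theory.
Local Open Scope ring_scope.

(* A directed graph on {1,...,m} is its edge set E; (w, v) \in E is w -> v. *)
Definition topological_order (m : nat) (E : {set 'I_m * 'I_m}) : Prop :=
  forall w v : 'I_m, (w, v) \in E -> (w < v)%N.

Definition algebraic_set (R : realType) (n : nat) (Z : set 'rV[R]_n) : Prop :=
  exists ps : seq {mpoly R[n]},
    forall x : 'rV[R]_n, Z x <-> (forall p, p \in ps -> p.@[x 0] = 0).

Definition proper_algebraic_set (R : realType) (n : nat)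
    (Z : set 'rV[R]_n) : Prop :=
  algebraic_set Z /\ Z <> [set: 'rV[R]_n]%classic.

(* f is total for convenience; only its values on S matter. *)
Definition generically_finite_to_one (R : realType) (n : nat) (T : Type)
    (S : set 'rV[R]_n) (f : 'rV[R]_n -> T) : Prop :=
  exists2 Z : set 'rV[R]_n, proper_algebraic_set Z &
    forall s, S s -> ~ Z s ->
      finite_set [set s' | S s' /\ f s' = f s]%classic.

Definition RE (R : realType) (m : nat) (E : {set 'I_m * 'I_m})
    (Lambda : 'M[R]_m) : Prop :=
  forall w v : 'I_m, (w, v) \notin E -> Lambda w v = 0.

Definition diag_pos (R : realType) (m : nat) (Omega : 'M[R]_m) : Prop :=
  is_diag_mx Omega /\ forall i, 0 < Omega i i.

Definition phi (R : realType) (m : nat)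
    (Lambda Omega : 'M[R]_m) (delta : 'cV[R]_m) : 'M[R]_m :=
  invmx (1%:M - Lambda^T) *m (Omega + delta *m delta^T)
    *m invmx (1%:M - Lambda).

(* The identification of R_E x {diagonal matrices} x R^m with R^(|E| + 2m):
   the coordinates are the edge coefficients (in the order of the enumeration
   of E), then the diagonal of Omega, then delta. *)
Definition Lambda_of (R : realType) (m : nat) (E : {set 'I_m * 'I_m})
    (x : 'rV[R]_(#|E| + (m + m))) : 'M[R]_m :=
  \sum_(k < #|E|)
    lsubmx x 0 k *: delta_mx (enum_val k).1 (enum_val k).2.

Definition Omega_of (R : realType) (m : nat) (E : {set 'I_m * 'I_m})
    (x : 'rV[R]_(#|E| + (m + m))) : 'M[R]_m :=
  diag_mx (lsubmx (rsubmx x)).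

Definition delta_of (R : realType) (m : nat) (E : {set 'I_m * 'I_m})
    (x : 'rV[R]_(#|E| + (m + m))) : 'cV[R]_m :=
  (rsubmx (rsubmx x))^T.

Definition Theta (R : realType) (m : nat) (E : {set 'I_m * 'I_m}) :
    set 'rV[R]_(#|E| + (m + m)) :=
  [set x | RE E (Lambda_of x) /\ diag_pos (Omega_of x)]%classic.

Definition phiG (R : realType) (m : nat) (E : {set 'I_m * 'I_m})
    (x : 'rV[R]_(#|E| + (m + m))) : 'M[R]_m :=
  phi (Lambda_of x) (Omega_of x) (delta_of x).

Definition generically_finitely_identifiable (R : realType) (m : nat)
    (E : {set 'I_m * 'I_m}) : Prop :=
  generically_finite_to_one (@Theta R m E) (@phiG R m E).

Lemma Lambda_ofE (R : realType) (m : nat) (E : {set 'I_m * 'I_m})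
    (x : 'rV[R]_(#|E| + (m + m))) (k : 'I_#|E|) :
  Lambda_of x (enum_val k).1 (enum_val k).2 = lsubmx x 0 k.
Proof.
rewrite /Lambda_of summxE (bigD1 k) //= !mxE !eqxx mulr1 big1 ?addr0 // => j.
move=> njk; rewrite !mxE -xpair_eqE -!surjective_pairing.
by rewrite (inj_eq enum_val_inj) eq_sym (negPf njk) mulr0.
Qed.

Lemma RE_Lambda_of (R : realType) (m : nat) (E : {set 'I_m * 'I_m})
    (x : 'rV[R]_(#|E| + (m + m))) : RE E (Lambda_of x).
Proof.
move=> w v nwv; rewrite /Lambda_of summxE big1 // => k _; rewrite !mxE.
rewrite -xpair_eqE -surjective_pairing; case: eqP => [e|_]; last first.
  by rewrite mulr0.
by move: (enum_valP k); rewrite -e (negPf nwv).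
Qed.

(* The coordinates are faithful: every (Lambda, Omega, delta) in
   R_E x diag_m^+ x R^m is represented by exactly one point of Theta. *)
Lemma Theta_bij (R : realType) (m : nat) (E : {set 'I_m * 'I_m})
    (Lambda Omega : 'M[R]_m) (delta : 'cV[R]_m) :
  RE E Lambda -> diag_pos Omega ->
  exists! x, @Theta R m E x /\
    [/\ Lambda_of x = Lambda, Omega_of x = Omega & delta_of x = delta].
Proof.
move=> LE [Od Op].
pose l : 'rV[R]_#|E| := \row_k Lambda (enum_val k).1 (enum_val k).2.
pose o : 'rV[R]_m := \row_i Omega i i.
pose x := row_mx l (row_mx o delta^T).
have eL : Lambda_of x = Lambda.
  apply/matrixP => w v; have [wvE|wvE] := boolP ((w, v) \in E).
    have := Lambda_ofE x (enum_rank_in wvE (w, v)).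
    by rewrite enum_rankK_in //= row_mxKl mxE enum_rankK_in.
  by rewrite LE // RE_Lambda_of.
have eO : Omega_of x = Omega.
  rewrite /Omega_of row_mxKr row_mxKl.
  have /is_diag_mxP Od' := Od.
  apply/matrixP => i j; rewrite !mxE.
  by case: eqVneq => [->|/Od' ->]; rewrite ?mulr1n ?mulr0n.
have ed : delta_of x = delta by rewrite /delta_of !row_mxKr trmxK.
exists x; split.
  by split=> //; split; [exact: RE_Lambda_of | rewrite eO].
move=> y [_ [yL yO yd]]; rewrite -[y]hsubmxK -[rsubmx y]hsubmxK.
congr (row_mx _ (row_mx _ _)).
- by apply/rowP => k; rewrite -Lambda_ofE yL mxE.
- by apply/rowP => i; rewrite mxE -yO !mxE eqxx mulr1n.
- by rewrite -yd trmxK.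
Qed.

(* An undirected graph is a symmetric irreflexive relation; the condition
   p.1 < p.2 counts each edge once. *)
Definition num_edges (m : nat) (e : rel 'I_m) : nat :=
  #|[set p : 'I_m * 'I_m | (p.1 < p.2)%N && e p.1 p.2]|.

Definition compl_graph (m : nat) (e : rel 'I_m) : rel 'I_m :=
  fun v w => (v != w) && ~~ e v w.

Definition components (m : nat) (e : rel 'I_m) : {set {set 'I_m}} :=
  [set [set w | connect e v w] | v : 'I_m].

Definition contains_odd_cycle (m : nat) (e : rel 'I_m) (C : {set 'I_m}) : Prop :=
  exists p : seq 'I_m,
    [/\ {subset p <= C}, (2 < size p)%N, odd (size p) & ucycle e p].

Definition num_components_without_odd_cycle (m : nat) (e : rel 'I_m) : nat :=
  #|[set C in components e | ~~ `[< contains_odd_cycle e C >]]|.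

Definition SigmaL (R : realType) (m : nat) (Lambda Omega : 'M[R]_m) : 'M[R]_m :=
  invmx (1%:M - Lambda^T) *m Omega *m invmx (1%:M - Lambda).

Definition Gcov (R : realType) (m : nat) (E : {set 'I_m * 'I_m}) : rel 'I_m :=
  fun v w => (v != w) &&
    `[< ~ (forall Lambda Omega : 'M[R]_m, RE E Lambda -> diag_pos Omega ->
             SigmaL Lambda Omega v w = 0) >].

Definition Gcon (R : realType) (m : nat) (E : {set 'I_m * 'I_m}) : rel 'I_m :=
  fun v w => (v != w) &&
    `[< ~ (forall Lambda Omega : 'M[R]_m, RE E Lambda -> diag_pos Omega ->
             invmx (SigmaL Lambda Omega) v w = 0) >].

Lemma SigmaL_sym (R : realType) (m : nat) (Lambda Omega : 'M[R]_m) :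
  diag_pos Omega -> (SigmaL Lambda Omega)^T = SigmaL Lambda Omega.
Proof.
move=> [/is_diag_mxP Od _]; have eO : Omega^T = Omega.
  apply/matrixP => i j; rewrite mxE.
  by have [->//|nij] := eqVneq i j; rewrite !Od // eq_sym.
by rewrite /SigmaL !trmx_mul eO !trmx_inv !linearB /= !trmx1 trmxK mulmxA.
Qed.

Lemma Gcov_sym (R : realType) (m : nat) (E : {set 'I_m * 'I_m}) :
  ssrbool.symmetric (Gcov R E).
Proof.
move=> v w; rewrite /Gcov eq_sym; congr (_ && _); apply: asbool_equiv_eq.
by split=> H H'; apply: H => L O HL HO; rewrite -SigmaL_sym // mxE H'.
Qed.

Lemma Gcon_sym (R : realType) (m : nat) (E : {set 'I_m * 'I_m}) :
  ssrbool.symmetric (Gcon R E).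
Proof.
move=> v w; rewrite /Gcon eq_sym; congr (_ && _); apply: asbool_equiv_eq.
by split=> H H'; apply: H => L O HL HO;
  rewrite -SigmaL_sym // -trmx_inv mxE H'.
Qed.

Lemma compl_graph_sym (m : nat) (e : rel 'I_m) :
  ssrbool.symmetric e -> ssrbool.symmetric (compl_graph e).
Proof. by move=> es v w; rewrite /compl_graph eq_sym es. Qed.

(* Main.v *)
Require Import Defs.
From HB Require Import structures.
From mathcomp Require Import all_boot all_order all_algebra.
From mathcomp Require Import boolp classical_sets cardinality reals.
From mathcomp Require Import topology normedtype derive exp.
From mathcomp Require Import lra ring zify.
From mathcomp Require mpoly.

(** Both bounds are instances of one dimension count.  Put
    B = (I - Lambda)^-1 and gamma = B^T delta.  Then
      Sigma = SigmaL + gamma gamma^T   (phiG_cov_loading),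
    so off the edges of G_cov the entries of Sigma are the products
    gamma_v gamma_w.  By the Sherman-Morrison formula
      Sigma^-1 = SigmaL^-1 - (1 + q)^-1 kappa kappa^T,
    with kappa = (I - Lambda) Omega^-1 delta and q = delta^T Omega^-1 delta
    (cov_loading, conc_loading, signal_noise below are gamma, kappa, q),
    so off the edges of G_con the entries of Sigma^-1 are, up to sign, again
    products u_v u_w, with u = kappa / sqrt (1 + q).

    Where u > 0, the logarithms of the products u_v u_w over the edges of the
    complement graph are A ln u, with A the edge-vertex incidence matrix of that
    graph.  A component without odd cycle is bipartite, and the sign vector of
    its bipartition is killed by A; these vectors have disjoint supports, so
    rank A <= m - d (incidence_rank).  Hence the m diagonal entries, the entries
    on the edges of the graph, and rank A further ones determine the whole
    matrix.  If these were fewer than the 2m + |E| parameters, infinitely many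
    parameters would share their values (infinite_fiber), hence share Sigma;
    this contradicts finiteness of the fibres.  So
      2m + |E| <= m + (number of edges) + (m - d)   (edge_bound),
    which is the claim.

    The analytic input is that fewer than n smooth functions on a nonempty open
    subset of R^n always have an infinite common fibre.  It is proved by
    eliminating one function and one variable at a time with an implicit
    function theorem in one unknown.  Smoothness is taken in the form of
    Hadamard: h y - h z = sum_j G_j(y, z) (y_j - z_j) with G_j continuous.  This
    is stable under all operations that occur, and for an implicitly defined
    function sigma the factors come out by solving one linear equation.

    The argument runs on a small open set near Lambda = 0, Omega = I,
    delta = (1, ..., 1), where gamma and kappa are positive; a proper algebraic
    set contains no nonempty open set, so the exceptional set of the generic
    finiteness hypothesis can be avoided there (generic_region). *)

Set Implicit Arguments.
Unset Strict Implicit.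
Unset Printing Implicit Defensive.

Import Order.TTheory GRing.Theory Num.Theory.
Import numFieldNormedType.Exports.
Local Open Scope ring_scope.

(** * Graphs: odd cycles, sign vectors and the incidence matrix *)

(** A closed walk of odd length that repeats a vertex splits there into two
    shorter closed walks, one of which is again odd. *)
Lemma odd_cycle_of_closed_walk m (e : rel 'I_m) (C : {set 'I_m}) p :
  irreflexive e -> {subset p <= C} -> odd (size p) -> cycle e p ->
  contains_odd_cycle e C.
Proof.
move=> irr; have [k] := ubnP (size p); elim: k p => // k IH p; rewrite ltnS => pk.
move=> pC op cp; have [up|] := boolP (uniq p).
  exists p; split=> //; last by apply/andP.
  by case: p op cp {pk pC up} => [//|x [|y [|z p]]] //= _; rewrite irr.
case: p pk pC op cp => [//|x0 p'] pk pC op cp /(uniqPn x0)[i [j [ij jp eij]]].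
set p := x0 :: p' in pk pC op cp jp eij.
(* Rotate the walk so that it starts at a repeated vertex. *)
have [x [q [xq rp]]] : exists x q, x \in q /\ rot i p = x :: q.
  exists (nth x0 p i), (drop i.+1 p ++ take i p); split; last first.
    by rewrite /rot (drop_nth x0) ?(ltn_trans ij) // cat_cons.
  rewrite mem_cat eij; apply/orP; left.
  apply/(nthP x0); exists (j - i.+1)%N.
    by rewrite size_drop ltn_sub2r // (leq_ltn_trans ij).
  by rewrite nth_drop subnKC.
have sp : size p = (size q).+1 by rewrite -(size_rot i) rp.
have qC : {subset x :: q <= C} by move=> y; rewrite -rp mem_rot; exact: pC.
move: cp; rewrite -(rot_cycle i) rp.
case/splitPr: q / xq rp sp qC => q1 q2 rp sp qC /=.
rewrite rcons_cat rcons_cons cat_path /= => /and3P[c1 c1' c2].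
rewrite sp size_cat /= in op pk.
have [o1|o1] := boolP (odd (size q1).+1).
  apply: (IH (x :: q1)) => //=.
  - by apply: leq_trans pk; rewrite ltnS addnS ltnS leq_addr.
  - move=> y yq; apply: qC; move: yq; rewrite !inE mem_cat.
    by case/orP => ->; rewrite ?orbT.
  - by rewrite rcons_path c1.
apply: (IH (x :: q2)) => //=.
- by apply: leq_trans pk; rewrite ltnS leq_addl.
- move=> y yq; apply: qC; move: yq; rewrite !inE mem_cat inE.
  by case/orP => ->; rewrite ?orbT.
- by move: op o1; rewrite /= oddD /=; case: (odd _); case: (odd _).
Qed.

(** Going along [p] and back along [q] closes up to an odd walk. *)
Lemma odd_cycle_of_parity m (e : rel 'I_m) r p q :
  ssrbool.symmetric e -> irreflexive e -> path e r p -> path e r q ->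
  last r p = last r q -> odd (size p) -> ~~ odd (size q) ->
  contains_odd_cycle e [set w | connect e r w].
Proof.
move=> es irr rp rq pq op oq.
pose c := p ++ rev (belast r q).
have rc : path e r c.
  rewrite cat_path rp pq rev_path.
  by rewrite (eq_path (e' := e)) // => x y; rewrite /= es.
have oc : odd (size c) by rewrite size_cat size_rev size_belast oddD op (negPf oq).
have lc : last r c = r.
  rewrite last_cat; case: q {rq oc oq rc} @c pq => [//|y q] /= _.
  by rewrite rev_cons last_rcons.
have cC : {subset c <= [set w | connect e r w]}.
  by move=> x xc; rewrite inE; apply: (path_connect rc); rewrite inE xc orbT.
apply: (odd_cycle_of_closed_walk irr cC oc).
case/lastP: c rc lc {oc cC} => [//|c x] rc; rewrite last_rcons => xr.
by move: rc; rewrite -(rotr_cycle 1) rotr1_rcons /= xr.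
Qed.

Section Incidence.
Context {R : realType}.

(** The sign of a vertex is the parity of the walks from a root [r]; without an
    odd cycle it does not depend on the walk.  The normalization at [r] makes the
    independence of the sign vectors of different components visible. *)
Lemma bipartite_signing m (e : rel 'I_m) (C : {set 'I_m}) :
  ssrbool.symmetric e -> irreflexive e -> C \in components e ->
  ~ contains_odd_cycle e C ->
  exists r (eps : 'I_m -> R), [/\ r \in C, eps r = 1,
    forall v, v \notin C -> eps v = 0 & forall v w, e v w -> eps v + eps w = 0].
Proof.
move=> es irr /imsetP[r _ ->] noC; set C' := [set _ | _] in noC *.
pose even_walk v := exists p, [/\ path e r p, last r p = v & ~~ odd (size p)].
pose eps v : R := if v \in C' then if `[< even_walk v >] then 1 else -1 else 0.
exists r, eps.
have rC : r \in C' by rewrite inE connect0.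
split=> //.
- by rewrite /eps rC asboolT //; exists [::].
- by move=> v /negPf; rewrite /eps => ->.
move=> v w vw; rewrite /eps.
have -> : (w \in C') = (v \in C').
  rewrite !inE; apply/idP/idP => rw.
    by apply: connect_trans rw _; apply: connect1; rewrite es.
  by apply: connect_trans rw _; apply: connect1.
have [vC|_] := boolP (v \in C'); last by rewrite addr0.
case: (asboolP (even_walk v)) => [[p [rp lp op]]|nv];
  case: (asboolP (even_walk w)) => [[q [rq lq oq]]|nw].
- exfalso; apply: noC; apply: (@odd_cycle_of_parity _ _ _ (rcons p w) q) => //.
  + by rewrite rcons_path rp lp.
  + by rewrite last_rcons.
  + by rewrite size_rcons.
- by rewrite subrr.
- by rewrite addNr.
- move: vC; rewrite inE => /connectP[p rp lp].
  have [op|op] := boolP (odd (size p)); last by case: nv; exists p.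
  case: nw; exists (rcons p w); split; first by rewrite rcons_path rp -lp.
    by rewrite last_rcons.
  by rewrite size_rcons /= op.
Qed.

Definition incidence_mx m N (p : 'I_N -> 'I_m * 'I_m) : 'M[R]_(N, m) :=
  \matrix_(k, j) ((j == (p k).1)%:R + (j == (p k).2)%:R).

Lemma incidence_mxE m N (p : 'I_N -> 'I_m * 'I_m) (x : 'cV_m) k :
  (incidence_mx p *m x) k 0 = x (p k).1 0 + x (p k).2 0.
Proof.
rewrite mxE; under eq_bigr do rewrite mxE mulrDl.
have dE (i : 'I_m) : \sum_j (j == i)%:R * x j 0 = x i 0.
  rewrite (bigD1 i) //= eqxx mul1r big1 ?addr0 // => j /negPf->.
  by rewrite mul0r.
by rewrite big_split /= !dE.
Qed.

(** The sign vectors of the bipartite components lie in the kernel of the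
    incidence matrix and, having disjoint supports, are linearly independent. *)
Lemma incidence_rank m (e : rel 'I_m) N (p : 'I_N -> 'I_m * 'I_m) :
  ssrbool.symmetric e -> irreflexive e -> (forall k, e (p k).1 (p k).2) ->
  (\rank (incidence_mx p) + num_components_without_odd_cycle e <= m)%N.
Proof.
move=> es irr pe.
set S := [set C in components e | ~~ `[< contains_odd_cycle e C >]].
rewrite /num_components_without_odd_cycle -/S.
have /choice[r /choice[eps epsP]] (k : 'I_#|S|) : exists r (eps : 'I_m -> R),
   [/\ r \in enum_val k, eps r = 1,
    forall v, v \notin enum_val k -> eps v = 0
    & forall v w, e v w -> eps v + eps w = 0].
  have := enum_valP k; rewrite inE => /andP[kC nC].
  move: nC => /asboolPn nC.
  exact: bipartite_signing kC nC.
pose B : 'M[R]_(#|S|, m) := \matrix_(k, j) eps k j.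
have AB : incidence_mx p *m B^T = 0.
  apply/matrixP => k l.
  have -> : (incidence_mx p *m B^T) k l = (incidence_mx p *m col l B^T) k 0.
    by rewrite !mxE; apply: eq_bigr => j _; rewrite !mxE.
  rewrite incidence_mxE !mxE.
  by have [_ _ _] := epsP l; apply.
have rB : row_free B.
  apply/row_freeP; exists (\matrix_(j, l) (j == r l)%:R).
  apply/matrixP => k l; rewrite mxE (bigD1 (r l)) //=.
  rewrite !mxE eqxx mulr1 big1 ?addr0; last first.
    by move=> j /negPf jl; rewrite !mxE jl mulr0.
  have [rk ek e0 _] := epsP k.
  have [->|kl] := eqVneq k l; first by have [_ ->] := epsP l.
  apply: e0; apply: contra kl => rlk; have [rl _ _ _] := epsP l.
  apply/eqP/enum_val_inj.
  have := enum_valP k; have := enum_valP l; rewrite !inE => /andP[lC _] /andP[kC _].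
  move: lC kC rl rlk => /imsetP[x _ ->] /imsetP[y _ ->]; rewrite !inE => xr yr.
  apply/setP => z; rewrite !inE.
  have sc := sym_connect_sym es.
  by rewrite (same_connect sc yr) (same_connect sc xr).
have := mulmx0_rank_max AB; rewrite mxrank_tr.
by move: rB => /eqP ->.
Qed.

End Incidence.

(** * Smooth functions on subsets of R^n *)

Local Open Scope classical_set_scope.

Section Analysis.
Context {R : realType}.

(** Neighbourhoods of a row vector are products of those of its entries. *)
Lemma cvg_rV (T : Type) (F : set_system T) {FF : Filter F} n
    (f : T -> 'rV[R]_n) (y : 'rV[R]_n) :
  (forall j, (fun t => f t 0 j) @ F --> y 0 j) -> f @ F --> y.
Proof.
move=> fy A [P Py PA].
have : \forall t \near F, forall j, P 0 j (f t 0 j).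
  by apply: filter_forall => j; apply: fy; exact: Py.
apply: filterS => t Pt; apply: PA => i j; rewrite (ord1 i); exact: Pt.
Qed.

Lemma continuous_pair (T U V : topologicalType) (f : T -> U) (g : T -> V) x :
  {for x, continuous f} -> {for x, continuous g} ->
  {for x, continuous (fun t => (f t, g t))}.
Proof.
move=> fc gc.
exact: (@cvg_pair _ _ _ (nbhs x) (nbhs (f x)) (nbhs (g x)) _ _ _ f g fc gc).
Qed.

Lemma continuous_sum (T : topologicalType) (I : Type) (r : seq I) (P : pred I)
    (f : I -> T -> R) x :
  (forall i, P i -> {for x, continuous (f i)}) ->
  {for x, continuous (fun t => \sum_(i <- r | P i) f i t)}.
Proof. by move=> fc; apply: cvg_big => //; exact: add_continuous. Qed.

(** Hadamard's form of continuous differentiability: [G j (x, x)] is the [j]-th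
    partial derivative at [x].  The factors [G] are not unique, and the identity
    is required on all of [U] x [U], not only near the diagonal, so that no
    shrinking of domains is needed in the closure properties below. *)
Definition slopes n (U : set 'rV[R]_n) (h : 'rV[R]_n -> R)
    (G : 'I_n -> 'rV[R]_n * 'rV[R]_n -> R) :=
  forall y z, U y -> U z ->
    h y - h z = \sum_j G j (y, z) * (y 0 j - z 0 j)
    /\ forall j, {for (y, z), continuous (G j)}.

Definition smooth_on n (U : set 'rV[R]_n) (h : 'rV[R]_n -> R) :=
  exists G, slopes U h G.

Lemma smooth_on_sub n (U V : set 'rV[R]_n) h :
  V `<=` U -> smooth_on U h -> smooth_on V h.
Proof. by move=> VU [G HG]; exists G => y z /VU Uy /VU Uz; exact: HG. Qed.

Lemma smooth_on_eq n (U : set 'rV[R]_n) h h' :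
  (forall x, U x -> h x = h' x) -> smooth_on U h -> smooth_on U h'.
Proof. by move=> e [G HG]; exists G => y z Uy Uz; rewrite -!e //; exact: HG. Qed.

Lemma smooth_on_continuous n (U : set 'rV[R]_n) h x :
  open U -> smooth_on U h -> U x -> {for x, continuous h}.
Proof.
move=> oU [G HG] Ux.
rewrite /prop_for /continuous_at.
have -> : nbhs (h x) = nbhs (h x + \sum_j G j (x, x) * (x 0 j - x 0 j)).
  by congr nbhs; rewrite big1 ?addr0 // => j _; rewrite subrr mulr0.
have nU : \forall y \near x, U y by exact: open_nbhs_nbhs.
have e : {near x, (fun y => h x + \sum_j G j (y, x) * (y 0 j - x 0 j)) =1 h}.
  by apply: filterS nU => y Uy; have [<- _] := HG y x Uy Ux; rewrite addrC subrK.
apply: (cvg_trans (near_eq_cvg e)).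
suff gc : {for x, continuous (fun y => \sum_j G j (y, x) * (y 0 j - x 0 j))}.
  exact: (cvgD (cvg_cst _) gc).
apply: continuous_sum => j _.
have Gc : (fun y => G j (y, x)) @ x --> G j (x, x).
  have [_ /(_ j)] := HG x x Ux Ux.
  apply: (@continuous_comp _ _ _ (fun y => (y, x)) (G j)).
  by apply: continuous_pair; [exact: cvg_id|exact: cst_continuous].
exact: (cvgM Gc (cvgB (@coord_continuous _ _ _ 0 j x) (cvg_cst _))).
Qed.

Lemma smooth_on_cst n (U : set 'rV[R]_n) c : smooth_on U (fun=> c).
Proof.
exists (fun _ _ => 0) => y z _ _; split; last by move=> j; exact: cvg_cst.
by rewrite subrr big1 // => j _; rewrite mul0r.
Qed.

Lemma smooth_on_coord n (U : set 'rV[R]_n) i : smooth_on U (fun x => x 0 i).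
Proof.
exists (fun j _ => (j == i)%:R) => y z _ _; split; last by move=> j; exact: cvg_cst.
rewrite (bigD1 i) //= eqxx mul1r big1 ?addr0 // => j /negPf->.
by rewrite mul0r.
Qed.

Lemma smooth_onD n (U : set 'rV[R]_n) f g :
  smooth_on U f -> smooth_on U g -> smooth_on U (fun x => f x + g x).
Proof.
move=> [F HF] [G HG]; exists (fun j p => F j p + G j p) => y z Uy Uz.
have [eF cF] := HF _ _ Uy Uz; have [eG cG] := HG _ _ Uy Uz; split.
  rewrite opprD addrACA eF eG -big_split; apply: eq_bigr => j _ /=.
  by rewrite mulrDl.
by move=> j; apply: cvgD; [exact: cF|exact: cG].
Qed.

Lemma smooth_onM n (U : set 'rV[R]_n) f g : open U ->
  smooth_on U f -> smooth_on U g -> smooth_on U (fun x => f x * g x).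
Proof.
move=> oU sf sg.
have cf := smooth_on_continuous oU sf; have cg := smooth_on_continuous oU sg.
have [F HF] := sf; have [G HG] := sg.
exists (fun j p => F j p * g p.1 + f p.2 * G j p) => y z Uy Uz.
have [eF cF] := HF _ _ Uy Uz; have [eG cG] := HG _ _ Uy Uz; split.
  have -> : f y * g y - f z * g z = (f y - f z) * g y + f z * (g y - g z).
    by rewrite mulrBl mulrBr addrA subrK.
  rewrite eF eG mulr_suml mulr_sumr -big_split; apply: eq_bigr => j _ /=.
  by rewrite mulrDl mulrAC -!mulrA.
move=> j; apply: cvgD; apply: cvgM; [exact: cF| | |exact: cG].
  by apply: (continuous_comp (f := fst) (g := g)); [exact: cvg_fst|exact: cg].
by apply: (continuous_comp (f := snd) (g := f)); [exact: cvg_snd|exact: cf].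
Qed.

Lemma smooth_onV n (U : set 'rV[R]_n) f : open U -> (forall x, U x -> f x != 0) ->
  smooth_on U f -> smooth_on U (fun x => (f x)^-1).
Proof.
move=> oU f0 sf; have cf := smooth_on_continuous oU sf.
have [F HF] := sf.
exists (fun j p => - (f p.1)^-1 * (f p.2)^-1 * F j p) => y z Uy Uz.
have [eF cF] := HF _ _ Uy Uz; split.
  rewrite [RHS](eq_bigr (fun j => - (f y)^-1 * (f z)^-1 *
    (F j (y, z) * (y 0 j - z 0 j)))) /=; last by move=> j _; rewrite mulrA.
  rewrite -mulr_sumr -eF mulrBr !mulNr mulrAC mulVf ?f0 // mul1r.
  by rewrite -mulrA mulVf ?f0 // mulr1 opprK addrC.
move=> j; apply: cvgM; last exact: cF.
apply: cvgM; [apply: cvgN|]; apply: cvgV; try exact: f0.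
  by apply: (continuous_comp (f := fst) (g := f)); [exact: cvg_fst|exact: cf].
by apply: (continuous_comp (f := snd) (g := f)); [exact: cvg_snd|exact: cf].
Qed.

Lemma smooth_on_sum n (U : set 'rV[R]_n) (I : Type) (r : seq I) (P : pred I) f :
  (forall i, P i -> smooth_on U (f i)) ->
  smooth_on U (fun x => \sum_(i <- r | P i) f i x).
Proof.
move=> sf; elim: r => [|i r IH].
  by apply: smooth_on_eq (smooth_on_cst _ 0) => x _; rewrite big_nil.
have [Pi|Pi] := boolP (P i).
  apply: smooth_on_eq (smooth_onD (sf i Pi) IH) => x _; by rewrite big_cons Pi.
by apply: smooth_on_eq IH => x _; rewrite big_cons (negPf Pi).
Qed.

Lemma smooth_on_prod n (U : set 'rV[R]_n) (I : Type) (r : seq I) (P : pred I) f :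
  open U -> (forall i, P i -> smooth_on U (f i)) ->
  smooth_on U (fun x => \prod_(i <- r | P i) f i x).
Proof.
move=> oU sf; elim: r => [|i r IH].
  by apply: smooth_on_eq (smooth_on_cst _ 1) => x _; rewrite big_nil.
have [Pi|Pi] := boolP (P i).
  apply: smooth_on_eq (smooth_onM oU (sf i Pi) IH) => x _; by rewrite big_cons Pi.
by apply: smooth_on_eq IH => x _; rewrite big_cons (negPf Pi).
Qed.

Lemma smooth_on_comp n k (U : set 'rV[R]_n) (V : set 'rV[R]_k)
    (psi : 'rV[R]_n -> 'rV[R]_k) h : open U ->
  (forall x, U x -> V (psi x)) ->
  (forall j, smooth_on U (fun x => psi x 0 j)) -> smooth_on V h ->
  smooth_on U (fun x => h (psi x)).
Proof.
move=> oU UV spsi [H HH].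
have cpsi x : U x -> {for x, continuous psi}.
  move=> Ux; apply: (@cvg_rV _ (nbhs x)) => j.
  exact: (smooth_on_continuous oU (spsi j) Ux).
have [G HG] := choice spsi.
exists (fun j p => \sum_l H l (psi p.1, psi p.2) * G l j p) => y z Uy Uz.
have [eH cH] := HH _ _ (UV _ Uy) (UV _ Uz); split.
  rewrite eH; under [RHS]eq_bigr do rewrite mulr_suml.
  rewrite exchange_big; apply: eq_bigr => l _ /=.
  have [-> _] := HG l _ _ Uy Uz; rewrite mulr_sumr; apply: eq_bigr => j _.
  by rewrite mulrA.
move=> j; apply: continuous_sum => l _.
apply: cvgM; last first.
  by have [_] := HG l _ _ Uy Uz; apply.
apply: (continuous_comp (f := fun p => (psi p.1, psi p.2)) (g := H l));
  last exact: cH.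
apply: continuous_pair.
  by apply: (continuous_comp (f := fst) (g := psi)); [exact: cvg_fst|exact: cpsi].
by apply: (continuous_comp (f := snd) (g := psi)); [exact: cvg_snd|exact: cpsi].
Qed.

(** On a ball, every point is joined to the centre by a segment; along it the
    derivative of [h] is given by the vanishing diagonal values of [G], and the
    mean value theorem applies. *)
Lemma slopes0_constant n (x0 : 'rV[R]_n) e h G : 0 < e ->
  slopes (ball x0 e) h G -> (forall x, ball x0 e x -> forall j, G j (x, x) = 0) ->
  forall y, ball x0 e y -> h y = h x0.
Proof.
move=> e0 HG G0 y By; pose v := y - x0; pose p (t : R) := x0 + t *: v.
have Bp (t : R) : `|t| <= 1 -> ball x0 e (p t).
  move=> t1; rewrite -ball_normE /= /p opprD addNKr normrN normrZ.
  apply: le_lt_trans (_ : `|v| < e).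
    by rewrite -[leRHS]mul1r ler_wpM2r.
  by move: By; rewrite -ball_normE /= distrC.
have pc : continuous p.
  move=> t; apply: cvgD; [exact: cvg_cst|apply: cvgZl; exact: cvg_id].
have hc t : `|t| <= 1 -> {for t, continuous (h \o p)}.
  move=> t1; apply: continuous_comp; first exact: pc.
  by apply: (smooth_on_continuous (ball_open _ _)) (Bp _ t1); exists G.
have : {within `[0, 1], continuous (h \o p)}.
  apply: continuous_in_subspaceT => t; rewrite inE /= in_itv /= => /andP[t0 t1].
  by apply: hc; rewrite ger0_norm.
have df (t : R) : t \in `]0, 1[%R -> is_derive t 1 (h \o p) 0.
  rewrite in_itv /= => /andP[t0 t1].
  have nt : \forall s \near (0 : R)^', `|s + t| <= 1.
    have d0 : 0 < Num.min t (1 - t) by rewrite lt_min t0 subr_gt0.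
    apply: filterS (@nbhs_dnbhs _ 0 _ (nbhs0_lt d0)) => s.
    rewrite lt_min ltr_norml ltr_norml => /andP[/andP[s1 _] /andP[_ s2]].
    by rewrite ler_norml; apply/andP; split; lra.
  pose dq (s : R) := s^-1 *: (((h \o p) \o shift t) (s *: 1) - (h \o p) t).
  suff cv : dq @ 0^' --> (0 : R).
    by apply: DeriveDef; [apply/cvg_ex; exists 0|apply/cvg_lim].
  pose q (s : R) := \sum_j G j (p (s + t), p t) * v 0 j.
  have t1' : `|t| <= 1 by rewrite ger0_norm ltW.
  have q0 : q 0 = 0.
    by apply: big1 => j _; rewrite add0r G0 ?mul0r //; exact: Bp.
  have qc : {for 0, continuous q}.
    apply: continuous_sum => j _.
    apply: cvgM; last exact: cvg_cst.
    have t2 : `|0 + t| <= 1 by rewrite add0r.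
    have [_ /(_ j)] := HG _ _ (Bp _ t2) (Bp _ t1').
    move=> Gc.
    apply: (continuous_comp (f := fun s => (p (s + t), p t)) (g := G j)) Gc.
    apply: continuous_pair; last exact: cst_continuous.
    apply: continuous_comp (pc _).
    by apply: cvgD; [exact: cvg_id|exact: cvg_cst].
  have e' : {near 0^', q =1 dq}.
    have : \forall s \near (0 : R)^', s != 0 by exact: nbhs_dnbhs_neq.
    apply: filterS2 nt => s s1 s0; rewrite /dq /=.
    have s1' : `|s *: 1 + t| <= 1 by rewrite /GRing.scale /= mulr1.
    have [-> _] := HG _ _ (Bp _ s1') (Bp _ t1').
    rewrite scaler_sumr; apply: eq_bigr => j _.
    have -> : s *: 1 = s by rewrite /GRing.scale /= mulr1.
    rewrite /q /p !mxE; set g := G _ _.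
    by rewrite /GRing.scale /=; field.
  apply: (cvg_trans (near_eq_cvg e')).
  by move: qc => /continuous_withinNx; rewrite q0.
move=> /(MVT ltr01 df)[c _].
rewrite mul0r /= /p scale0r addr0 scale1r /v subrKC => /eqP.
by rewrite subr_eq0 => /eqP.
Qed.

(** * The implicit function theorem in one unknown, and infinite fibres *)

Definition insert_coord n (i : 'I_n.+1) (s : R) (x : 'rV[R]_n) : 'rV[R]_n.+1 :=
  \row_j oapp (fun k => x 0 k) s (unlift i j).

Lemma insert_coord_eq n (i : 'I_n.+1) s x : insert_coord i s x 0 i = s.
Proof. by rewrite mxE unlift_none. Qed.

Lemma insert_coord_lift n (i : 'I_n.+1) s x k :
  insert_coord i s x 0 (lift i k) = x 0 k.
Proof. by rewrite mxE liftK. Qed.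

Lemma insert_coordK n (i : 'I_n.+1) (x : 'rV[R]_n.+1) :
  insert_coord i (x 0 i) (col' i x) = x.
Proof.
apply/rowP => j; case: (unliftP i j) => [k|] ->.
  by rewrite insert_coord_lift mxE.
by rewrite insert_coord_eq.
Qed.

Lemma col'_insert_coord n (i : 'I_n.+1) s x : col' i (insert_coord i s x) = x.
Proof. by apply/rowP => k; rewrite mxE insert_coord_lift. Qed.

Lemma continuous_insert_coord (T : topologicalType) n (i : 'I_n.+1) (s : T -> R)
    (f : T -> 'rV[R]_n) t : {for t, continuous s} -> {for t, continuous f} ->
  {for t, continuous (fun t => insert_coord i (s t) (f t))}.
Proof.
move=> sc fc; apply: (@cvg_rV _ (nbhs t)) => j.
case: (unliftP i j) => [k|] ->; last first.
  by under eq_fun do rewrite insert_coord_eq; rewrite insert_coord_eq.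
under eq_fun do rewrite insert_coord_lift; rewrite insert_coord_lift.
apply: (continuous_comp (g := fun x : 'rV[R]_n => x 0 k)) => //.
exact: coord_continuous.
Qed.

Lemma ball_insert_coord n (i : 'I_n.+1) (x0 : 'rV[R]_n.+1) r s x : 
  `|s - x0 0 i| < r -> ball (col' i x0) r x -> ball x0 r (insert_coord i s x).
Proof.
move=> sr [r0 xr]; split=> // k j; rewrite (ord1 k) {k}.
case: (unliftP i j) => [k|] ->; last first.
  by rewrite insert_coord_eq -ball_normE /= distrC.
by rewrite insert_coord_lift; have := xr 0 k; rewrite mxE.
Qed.

(** After division by [G i (x0, x0)] the function [h - h x0] is strictly
    increasing in the [i]-th coordinate near [x0], so the intermediate value
    theorem yields a zero [sigma x] of it.  Since [h] takes the same value at
    the points over [x] and [z], its slope identity between them can be solved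
    for [sigma x - sigma z]; this bounds [sigma] locally in the Lipschitz sense,
    hence makes it continuous, and then exhibits its slopes. *)
Lemma implicit_function n (U : set 'rV[R]_n.+1) h G i x0 :
  open U -> U x0 -> slopes U h G -> G i (x0, x0) != 0 ->
  exists (W : set 'rV[R]_n) sigma, [/\ open W, W !=set0,
    forall x, W x -> U (insert_coord i (sigma x) x) /\
                     h (insert_coord i (sigma x) x) = h x0
    & smooth_on W sigma].
Proof.
move=> oU Ux0 HG; set c := G i (x0, x0) => c0.
have nU : \forall p \near (x0, x0), U p.1.
  apply: (@cvg_fst _ _ (nbhs x0) (nbhs x0) _ U); exact: open_nbhs_nbhs.
(* M bounds all slopes near x0; it enters the Lipschitz bound for sigma. *)
pose M : R := \sum_j `|G j (x0, x0)| + 1.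
have [_ Gc] := HG _ _ Ux0 Ux0.
have nM : \forall p \near (x0, x0), forall j, `|G j p| < M.
  apply: (@filter_forall _ _ (fun j p => `|G j p| < M) (nbhs (x0, x0))) => j.
  have Mj : `|G j (x0, x0)| < M.
    by rewrite /M (bigD1 j) //= -addrA ltrDl ltr_wpDl // sumr_ge0.
  exact: (cvgr_lt _ (cvg_norm (Gc j)) _ Mj).
have nK : \forall p \near (x0, x0), 1 / 2 < G i p / c.
  have cK : (fun p => G i p / c) @ (x0, x0) --> G i (x0, x0) / c.
    by apply: (cvgM (Gc i)); exact: cvg_cst.
  apply: (cvgr_gt _ cK); rewrite divff //; lra.
have [r /= r0 Br] : exists2 r : R, 0 < r & forall y z, ball x0 r y -> ball x0 r z ->
    [/\ U y, forall j, `|G j (y, z)| < M & 1 / 2 < G i (y, z) / c].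
  have : nbhs (x0, x0)
      [set p | [/\ U p.1, forall j, `|G j p| < M & 1 / 2 < G i p / c]].
    by apply: filterS3 nU nM nK.
  move=> /nbhs_ballP[r /= r0 Br].
  by exists r => // y z By Bz; apply: (Br (y, z)).
have {nU nM nK}BU y : ball x0 r y -> U y by move=> By; have [] := Br _ _ By By.
have GI y z : ball x0 r y -> ball x0 r z -> G i (y, z) != 0.
  move=> By Bz; have [_ _] := Br _ _ By Bz.
  by apply: contraTneq => ->; rewrite mul0r; lra.
pose H y := (h y - h x0) / c.
have Hx0 : H x0 = 0 by rewrite /H subrr mul0r.
have Hc y : ball x0 r y -> {for y, continuous H}.
  move=> /BU Uy.
  have hc : h @ y --> h y by apply: smooth_on_continuous Uy => //; exists G.
  exact: (cvgM (cvgB hc (cvg_cst (h x0))) (cvg_cst c^-1)).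
have Hs s t x : ball x0 r (insert_coord i s x) -> ball x0 r (insert_coord i t x) ->
    s < t -> H (insert_coord i s x) < H (insert_coord i t x).
  move=> Bs Bt st; rewrite -subr_gt0 /H -mulrBl opprB addrA subrK.
  have [-> _] := HG _ _ (BU _ Bt) (BU _ Bs).
  rewrite (bigD1_ord i) //= big1 ?addr0; last first.
    by move=> k _; rewrite !insert_coord_lift subrr mulr0.
  rewrite !insert_coord_eq mulrAC; apply: mulr_gt0; last by rewrite subr_gt0.
  have [_ _] := Br _ _ Bt Bs; lra.
(* Half the radius keeps the closed interval inside the ball. *)
pose a := x0 0 i - r / 2; pose b := x0 0 i + r / 2; pose p := col' i x0.
have pp : ball p r p by exact: ballxx.
have ab : a <= b by rewrite /a /b; lra.
have Bab s x : a <= s <= b -> ball p r x -> ball x0 r (insert_coord i s x).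
  move=> /andP[as_ sb]; apply: ball_insert_coord.
  by rewrite ltr_norml; apply/andP; split; move: as_ sb; rewrite /a /b; lra.
have Ba x : ball p r x -> ball x0 r (insert_coord i a x) by apply: Bab; rewrite lexx.
have Bb x : ball p r x -> ball x0 r (insert_coord i b x).
  by apply: Bab; rewrite lexx ab.
have Bx0 : ball x0 r (insert_coord i (x0 0 i) p).
  by rewrite insert_coordK; exact: ballxx.
have Hx0' : H (insert_coord i (x0 0 i) p) = 0 by rewrite insert_coordK.
have Ha : H (insert_coord i a p) < 0.
  rewrite -Hx0'; apply: Hs => //; first exact: Ba.
  by rewrite /a; lra.
have Hb : 0 < H (insert_coord i b p).
  rewrite -Hx0'; apply: Hs => //; first exact: Bb.
  by rewrite /b; lra.
have ic s x : {for x, continuous (insert_coord i s : 'rV[R]_n -> _)}.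
  by apply: continuous_insert_coord; [exact: cst_continuous|exact: cvg_id].
pose W0 := [set x : 'rV[R]_n | [/\ ball p r x, H (insert_coord i a x) < 0 &
   0 < H (insert_coord i b x)]].
have W0p : nbhs p W0.
  have n1 : nbhs p (ball p r) by exact: nbhsx_ballx.
  have n2 : \forall x \near p, H (insert_coord i a x) < 0.
    exact: (cvgr_lt _ (continuous_comp (ic a p) (Hc _ (Ba _ pp))) _ Ha).
  have n3 : \forall x \near p, 0 < H (insert_coord i b x).
    exact: (cvgr_gt _ (continuous_comp (ic b p) (Hc _ (Bb _ pp))) _ Hb).
  by apply: filterS3 n1 n2 n3.
pose W := W0°.
have WW0 : W `<=` W0 by exact: interior_subset.
have oW : open W by exact: open_interior.
have /choice[sigma sigmaP] : forall x,
    exists s, W x -> a <= s <= b /\ H (insert_coord i s x) = 0.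
  move=> x; have [Wx|] := pselect (W x); last by move=> nWx; exists 0.
  have [xr xa xb] := WW0 _ Wx.
  have cH : {within `[a, b], continuous (fun s => H (insert_coord i s x))}.
    apply: continuous_in_subspaceT => s; rewrite inE /= in_itv /= => sab.
    apply: (continuous_comp (f := fun s => insert_coord i s x) (g := H)).
      by apply: continuous_insert_coord; [exact: cvg_id|exact: cst_continuous].
    by apply: Hc; exact: Bab.
  have [|s sab Hs0] := IVT (v := 0) ab cH.
    by rewrite ge_min le_max (ltW xa) (ltW xb) orbT.
  by exists s => _; split=> //; move: sab; rewrite in_itv.
have BX x : W x -> ball x0 r (insert_coord i (sigma x) x).
  move=> Wx; have [sab _] := sigmaP _ Wx; apply: Bab => //.
  by have [] := WW0 _ Wx.
have hX x : W x -> h (insert_coord i (sigma x) x) = h x0.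
  move=> Wx; have [_ /eqP] := sigmaP _ Wx.
  by rewrite /H mulf_eq0 invr_eq0 (negPf c0) orbF subr_eq0 => /eqP.
pose X x := insert_coord i (sigma x) x.
have sE x z : W x -> W z -> sigma x - sigma z =
    \sum_k - (G (lift i k) (X x, X z) / G i (X x, X z)) * (x 0 k - z 0 k).
  move=> Wx Wz; have [+ _] := HG _ _ (BU _ (BX _ Wx)) (BU _ (BX _ Wz)).
  rewrite !hX // subrr (bigD1_ord i) //= !insert_coord_eq => /esym/eqP.
  rewrite addr_eq0 => /eqP e.
  apply: (mulfI (GI _ _ (BX _ Wx) (BX _ Wz))); rewrite e -sumrN mulr_sumr.
  apply: eq_bigr => k _; rewrite !insert_coord_lift -/(X x) -/(X z).
  by rewrite mulNr mulrN mulrA mulrCA mulfV ?mulr1 //; apply: GI; exact: BX.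
have sc z : W z -> {for z, continuous sigma}.
  move=> Wz; apply/(cvgrPdist_lt (F := nbhs z)) => e e0.
  (* The Lipschitz bound: slopes below M over a pivot of size above |c| / 2. *)
  pose g (x : 'rV[R]_n) := \sum_k (2 * M / `|c|) * `|x 0 k - z 0 k|.
  have gz : g z = 0 by apply: big1 => k _; rewrite subrr normr0 mulr0.
  have gc : {for z, continuous g}.
    apply: continuous_sum => k _.
    exact: (cvgM (cvg_cst _)
      (cvg_norm (cvgB (@coord_continuous _ _ _ 0 k z) (cvg_cst _)))).
  have n1 : \forall x \near z, W x by exact: open_nbhs_nbhs.
  have n2 : \forall x \near z, g x < e.
    by apply: (cvgr_lt _ gc); rewrite gz.
  apply: filterS2 n1 n2 => x Wx; apply: le_lt_trans.
  rewrite distrC sE //; apply: le_trans (ler_norm_sum _ _ _) _.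
  apply: ler_sum => k _; rewrite normrM normrN ler_wpM2r //.
  have [_ /(_ (lift i k)) GM GK] := Br _ _ (BX _ Wx) (BX _ Wz).
  have Gi : `|c| / 2 < `|G i (X x, X z)|.
    move: GK; rewrite -/(X x) -/(X z) => GK.
    have : 1 / 2 < `|G i (X x, X z) / c| by apply: lt_le_trans GK (ler_norm _).
    by rewrite normrM normfV ltr_pdivlMr ?normr_gt0 //; lra.
  rewrite normrM normfV mulrAC ler_pdivrMr; last first.
    by apply: le_lt_trans Gi; rewrite divr_ge0.
  have := normr_gt0 c; rewrite c0 => cp.
  have -> : 2 * `|c|^-1 * M * `|G i (X x, X z)| =
      M * (`|G i (X x, X z)| / (`|c| / 2)).
    by field; rewrite normr_eq0.
  rewrite -[leLHS]mulr1 ler_pM //; first exact: ltW.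
  by rewrite ler_pdivlMr ?mul1r ?divr_gt0 // ltW.
exists W, sigma; split => //.
- by exists p.
- by move=> x Wx; split; [exact: BU (BX _ Wx)|exact: hX].
exists (fun k q => - (G (lift i k) (X q.1, X q.2) / G i (X q.1, X q.2))).
move=> x z Wx Wz.
split=> [|k]; first exact: sE.
have Xc y : W y -> {for y, continuous X}.
  by move=> Wy; apply: continuous_insert_coord; [exact: sc|exact: cvg_id].
have Xc2 : {for (x, z), continuous (fun q => (X q.1, X q.2))}.
  apply: continuous_pair.
    by apply: (continuous_comp (f := fst) (g := X)); [exact: cvg_fst|exact: Xc].
  by apply: (continuous_comp (f := snd) (g := X)); [exact: cvg_snd|exact: Xc].
have [_ cG] := HG _ _ (BU _ (BX _ Wx)) (BU _ (BX _ Wz)).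
have cX l : {for (x, z), continuous (fun q => G l (X q.1, X q.2))}.
  exact: (continuous_comp Xc2 (cG l)).
exact: (cvgN (cvgM (cX (lift i k)) (cvgV (GI _ _ (BX _ Wx) (BX _ Wz)) (cX i)))).
Qed.

Lemma open_infinite n (U : set 'rV[R]_n) x0 :
  (0 < n)%N -> open U -> U x0 -> infinite_set U.
Proof.
case: n U x0 => [//|n] U x0 _ oU Ux0.
have /nbhs_ballP[e /= e0 BU] : nbhs x0 U by exact: open_nbhs_nbhs.
pose f (k : nat) : 'rV[R]_n.+1 := x0 + (e / k.+2%:R) *: const_mx 1.
have fU k : U (f k).
  apply: BU; split=> // i j; rewrite -ball_normE /= /f !mxE (ord1 i) mulr1.
  rewrite opprD addNKr normrN gtr0_norm ?divr_gt0 //.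
  by rewrite ltr_pdivrMr // ltr_pMr // ltr1n.
have finj : injective f.
  move=> k l /(congr1 (fun y : 'rV[R]_n.+1 => y 0 0)); rewrite !mxE !mulr1 => /addrI.
  move=> /(mulfI (lt0r_neq0 e0)) /invr_inj /eqP.
  by rewrite eqr_nat => /eqP[].
move=> /(finite_preimage (in2W finj)) finU; apply: infinite_nat.
by apply: sub_finite_set finU => k _; exact: fU.
Qed.

(** Induction on the number of functions.  If all derivatives of the first
    function vanish, it is constant on a ball and may be dropped.  Otherwise the
    implicit function theorem parametrizes a piece of its level set by one
    variable less, on which the remaining functions are again smooth. *)
Lemma infinite_fiber (J : eqType) (s : seq J) n (U : set 'rV[R]_n)
    (F : J -> 'rV[R]_n -> R) :
  (size s < n)%N -> open U -> U !=set0 -> (forall j, j \in s -> smooth_on U (F j)) ->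
  exists2 x, U x & infinite_set [set y | U y /\ forall j, j \in s -> F j y = F j x].
Proof.
elim: s n U F => [|j s IH] n U F sn oU [x0 Ux0] sF.
  exists x0 => //; apply: sub_infinite_set (open_infinite sn oU Ux0).
  by move=> y Uy; split.
have [G HG] := sF j (mem_head _ _).
have sF' k : k \in s -> smooth_on U (F k).
  by move=> ks; apply: sF; rewrite inE ks orbT.
have [[x [i [Ux Gx]]]|G0] := pselect (exists x i, U x /\ G i (x, x) != 0).
  case: n U F sn oU x0 Ux0 sF G HG sF' x i Ux Gx => [//|n] U F sn oU x0 Ux0.
  move=> sF G HG sF' x i Ux Gx.
  have [W [sigma [oW W0 WU ssigma]]] := implicit_function oU Ux HG Gx.
  pose X x := insert_coord i (sigma x) x.
  have [|] // := IH n W (fun k x => F k (X x)) sn oW W0.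
    move=> k ks; apply: smooth_on_comp (sF' _ ks) => //.
      by move=> z /WU[].
    move=> l; case: (unliftP i l) => [l'|] ->.
      apply: smooth_on_eq (smooth_on_coord _ l') => z _.
      by rewrite insert_coord_lift.
    by apply: smooth_on_eq ssigma => z _; rewrite insert_coord_eq.
  move=> y Wy infW; exists (X y); first by have [] := WU _ Wy.
  move=> /(finite_image (col' i)); apply: contra_not infW.
  apply: sub_finite_set => z [Wz Fz]; exists (X z); last exact: col'_insert_coord.
  split; first by have [] := WU _ Wz.
  move=> k; rewrite inE => /orP[/eqP->|]; last exact: Fz.
  by have [_ ->] := WU _ Wz; have [_ ->] := WU _ Wy.
have /nbhs_ballP[e /= e0 BU] : nbhs x0 U by exact: open_nbhs_nbhs.
have cj : forall y, ball x0 e y -> F j y = F j x0.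
  apply: (@slopes0_constant _ _ _ _ G) => //.
    by move=> y z /BU Uy /BU Uz; exact: HG.
  move=> x /BU Ux i; apply/eqP/contraT => Gx; exfalso; apply: G0.
  by exists x, i.
have [||] // := IH n (ball x0 e) F (ltnW sn) (ball_open _ _).
- by exists x0; exact: ballxx.
- by move=> k ks; apply: smooth_on_sub (sF' _ ks).
move=> y By infB; exists y; first exact: BU.
apply: sub_infinite_set infB => z [Bz Fz]; split; first exact: BU.
move=> k; rewrite inE => /orP[/eqP->|]; last exact: Fz.
by rewrite !cj.
Qed.

(** * Edge bound for a matrix family of rank one off the edges *)

(** The entries of [P] on the diagonal, on the edges, and on a set of nonedges
    indexing a row basis of the incidence matrix of the complement determine
    [P]: the logarithms of the other entries are linear combinations of the
    logarithms on the row basis.  If they were fewer than [n], they would have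
    an infinite fibre. *)
Lemma edge_bound m n (e : rel 'I_m) (U : set 'rV[R]_n)
    (P : 'rV[R]_n -> 'M[R]_m) (u : 'rV[R]_n -> 'I_m -> R) (c : R) :
  ssrbool.symmetric e -> open U -> U !=set0 -> c != 0 ->
  (forall x, U x -> (P x)^T = P x) ->
  (forall v w, smooth_on U (fun x => P x v w)) ->
  (forall x v, U x -> 0 < u x v) ->
  (forall x v w, U x -> v != w -> ~~ e v w -> P x v w = c * (u x v * u x w)) ->
  (forall x, U x -> finite_set [set y | U y /\ P y = P x]) ->
  (n + num_components_without_odd_cycle (compl_graph e) <= m + m + num_edges e)%N.
Proof.
move=> es oU U0 c0 Psym Psm u0 Pu fin.
pose NE := [set p : 'I_m * 'I_m | (p.1 < p.2)%N && compl_graph e p.1 p.2]%SET.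
pose ED := [set p : 'I_m * 'I_m | (p.1 < p.2)%N && e p.1 p.2]%SET.
pose A : 'M[R]_(#|NE|, m) := incidence_mx (fun k => enum_val k).
have rA : (\rank A + num_components_without_odd_cycle (compl_graph e) <= m)%N.
  apply: incidence_rank; first exact: compl_graph_sym.
    by move=> v; rewrite /compl_graph eqxx.
  by move=> k; have := enum_valP k; rewrite inE => /andP[].
pose f := maxrankfun A.
pose s := [seq (i, i) | i <- enum 'I_m] ++ enum ED ++
          [seq enum_val (f k) | k <- enum 'I_(\rank A)].
have ss : size s = (m + (num_edges e + \rank A))%N.
  by rewrite !size_cat !size_map -!enumT !size_enum_ord -cardE.
suff : (n <= size s)%N.
  by rewrite ss; move: rA; lia.
rewrite leqNgt; apply/negP => sn.
have [|x Ux] := infinite_fiber (F := fun p x => P x p.1 p.2) sn oU U0 _.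
  by move=> p _; exact: Psm.
apply; apply: sub_finite_set (fin x Ux) => y [Uy yx]; split=> //.
have half (v w : 'I_m) : (v < w)%N -> P y v w = P x v w.
  move=> vw; have nvw : v != w by apply: contraTneq vw => ->; rewrite ltnn.
  have [evw|evw] := boolP (e v w).
    by apply: (yx (v, w)); rewrite !mem_cat mem_enum inE /= vw evw orbT.
  pose l z := \col_j ln (u z j).
  have lE z k : U z -> (A *m l z) k 0 = ln (P z (enum_val k).1 (enum_val k).2 / c).
    move=> Uz; rewrite incidence_mxE !mxE.
    have := enum_valP k; rewrite inE => /and3P[_ n12 e12].
    rewrite Pu // [c * _]mulrC mulfK // lnM //; exact: u0.
  have lxy : A *m l y = A *m l x.
    have /submxP[X ->] : (A <= rowsub f A)%MS by rewrite eq_maxrowsub.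
    rewrite -!mulmxA !mul_rowsub_mx; congr (_ *m _); apply/matrixP => k j.
    rewrite (ord1 j) [LHS]mxE [RHS]mxE !lE //; congr (ln (_ / c)).
    apply: (yx (enum_val (f k))); rewrite !mem_cat.
    by rewrite (map_f (fun k => enum_val (f k))) ?orbT // mem_enum.
  have pNE : (v, w) \in NE by rewrite inE /= vw /compl_graph nvw evw.
  have := lE y (enum_rank_in pNE (v, w)) Uy.
  rewrite lxy lE // !enum_rankK_in //= => /ln_inj e'.
  have pos z : U z -> P z v w / c \in Num.pos.
    by move=> Uz; rewrite Pu // [c * _]mulrC mulfK // posrE mulr_gt0 ?u0.
  by have := e' (pos _ Ux) (pos _ Uy) => /(mulIf (invr_neq0 c0)).
apply/matrixP => v w; have [vw|wv|/val_inj <-] := ltngtP v w.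
- exact: half.
- by rewrite -(Psym x) // -(Psym y) // !mxE half.
- by apply: (yx (v, v)); rewrite mem_cat (map_f (fun i => (i, i))) // mem_enum.
Qed.

(** * Polynomials on open sets *)

Lemma smooth_on_meval n (U : set 'rV[R]_n) (p : mpoly.mpoly n R) : open U ->
  smooth_on U (fun x => mpoly.meval (x 0) p).
Proof.
move=> oU.
suff H : smooth_on U (fun x => \sum_(m <- mpoly.msupp p)
  mpoly.mcoeff m p * \prod_i \prod_(k < mpoly.fun_of_multinom m i) x 0 i).
  apply: smooth_on_eq H.
  move=> x _; rewrite mpoly.mevalE; apply: eq_bigr => m _; congr (_ * _).
  by apply: eq_bigr => i _; rewrite prodr_const card_ord.
apply: smooth_on_sum => m _; apply: smooth_onM => //; first exact: smooth_on_cst.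
do 2!apply: smooth_on_prod => // ? _; exact: smooth_on_coord.
Qed.

Lemma meval_line n (p : mpoly.mpoly n R) (x d : 'rV[R]_n) :
  exists q : {poly R}, forall t, mpoly.meval ((x + t *: d) 0) p = q.[t].
Proof.
exists (\sum_(m <- mpoly.msupp p) (mpoly.mcoeff m p)%:P *
  \prod_i ((x 0 i)%:P + (d 0 i)%:P * 'X) ^+ mpoly.fun_of_multinom m i) => t.
rewrite mpoly.mevalE horner_sum; apply: eq_bigr => m _.
rewrite hornerM hornerC horner_prod; congr (_ * _); apply: eq_bigr => i _.
by rewrite horner_exp !hornerE !mxE [t * _]mulrC.
Qed.

(** Among the [size q] numbers [e / (k + 2)] one is not a root. *)
Lemma poly_nonroot_small (q : {poly R}) e : q != 0 -> 0 < e ->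
  exists t, [/\ 0 < t, t < e & ~~ root q t].
Proof.
move=> q0 e0; pose f (k : nat) : R := e / k.+2%:R.
have finj : injective f.
  move=> k l /(mulfI (lt0r_neq0 e0)) /invr_inj /eqP.
  by rewrite eqr_nat => /eqP[].
pose rs := [seq f k | k <- iota 0 (size q)].
have : ~~ all (root q) rs.
  apply/negP => /(max_poly_roots q0).
  by rewrite map_inj_uniq // iota_uniq size_map size_iota ltnn => /(_ isT).
move=> /allPn[_ /mapP[k _ ->] nr]; exists (f k); split => //.
  by rewrite divr_gt0.
by rewrite ltr_pdivrMr // ltr_pMr // ltr1n.
Qed.

(** The restriction of [p] to the line from a point of [U] to [z] is a nonzero
    univariate polynomial, so it vanishes at finitely many points of the line
    only. *)
Lemma meval_nonzero_dense n (p : mpoly.mpoly n R) (U : set 'rV[R]_n) (z : 'rV[R]_n) :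
  open U -> U !=set0 -> mpoly.meval (z 0) p != 0 ->
  exists2 x, U x & mpoly.meval (x 0) p != 0.
Proof.
move=> oU [x0 Ux0] pz.
have /nbhs_ballP[e /= e0 BU] : nbhs x0 U by exact: open_nbhs_nbhs.
have [q qE] := meval_line p x0 (z - x0).
have q0 : q != 0.
  apply: contraNneq pz => q0; have := qE 1.
  by rewrite scale1r subrKC q0 horner0 => ->.
have d0 : 0 < e / (`|z - x0| + 1) by rewrite divr_gt0 // ltr_wpDl.
have [t [t0 te rt]] := poly_nonroot_small q0 d0.
exists (x0 + t *: (z - x0)); last by rewrite qE.
apply: BU; rewrite -ball_normE /= opprD addNKr normrN normrZ gtr0_norm //.
move: te; rewrite ltr_pdivlMr ?ltr_wpDl //; apply: le_lt_trans.
by rewrite ler_wpM2l ?ltW // ltrDl.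
Qed.

End Analysis.

(** * Smooth families of matrices *)

Section SmoothMx.
Context {R : realType} (n : nat) (U : set 'rV[R]_n) (oU : open U).

Definition smooth_mx p q (A : 'rV[R]_n -> 'M[R]_(p, q)) :=
  forall i j, smooth_on U (fun x => A x i j).

Lemma smooth_mx_cst p q (A : 'M[R]_(p, q)) : smooth_mx (fun=> A).
Proof. by move=> i j; exact: smooth_on_cst. Qed.

Lemma smooth_mxT p q (A : 'rV[R]_n -> 'M[R]_(p, q)) :
  smooth_mx A -> smooth_mx (fun x => (A x)^T).
Proof. by move=> sA i j; apply: smooth_on_eq (sA j i) => x _; rewrite mxE. Qed.

Lemma smooth_mxD p q (A B : 'rV[R]_n -> 'M[R]_(p, q)) :
  smooth_mx A -> smooth_mx B -> smooth_mx (fun x => A x + B x).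
Proof.
move=> sA sB i j; apply: smooth_on_eq (smooth_onD (sA i j) (sB i j)) => x _.
by rewrite mxE.
Qed.

Lemma smooth_mxM p q r (A : 'rV[R]_n -> 'M[R]_(p, q))
    (B : 'rV[R]_n -> 'M[R]_(q, r)) :
  smooth_mx A -> smooth_mx B -> smooth_mx (fun x => A x *m B x).
Proof.
move=> sA sB i j.
have /smooth_on_eq : smooth_on U (fun x => \sum_k A x i k * B x k j).
  by apply: smooth_on_sum => k _; apply: smooth_onM.
by apply=> x _; rewrite mxE.
Qed.

Lemma smooth_mxZ p q a (A : 'rV[R]_n -> 'M[R]_(p, q)) :
  smooth_on U a -> smooth_mx A -> smooth_mx (fun x => a x *: A x).
Proof.
move=> sa sA i j; apply: smooth_on_eq (smooth_onM oU sa (sA i j)) => x _.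
by rewrite mxE.
Qed.

Lemma smooth_mxN p q (A : 'rV[R]_n -> 'M[R]_(p, q)) :
  smooth_mx A -> smooth_mx (fun x => - A x).
Proof.
move=> /(smooth_mxZ (smooth_on_cst _ (-1))) sA i j.
by apply: smooth_on_eq (sA i j) => x _; rewrite scaleN1r.
Qed.

Lemma smooth_det p (A : 'rV[R]_n -> 'M[R]_p) :
  smooth_mx A -> smooth_on U (fun x => \det (A x)).
Proof.
move=> sA; apply: smooth_on_sum => s _; apply: smooth_onM => //.
  exact: smooth_on_cst.
by apply: smooth_on_prod.
Qed.

(** Cramer's rule. *)
Lemma smooth_invmx p (A : 'rV[R]_n -> 'M[R]_p) :
  (forall x, U x -> A x \in unitmx) -> smooth_mx A ->
  smooth_mx (fun x => invmx (A x)).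
Proof.
move=> uA sA i j.
have /smooth_on_eq : smooth_on U (fun x => (\det (A x))^-1 * cofactor (A x) j i).
  apply: smooth_onM => //.
    apply: smooth_onV (smooth_det sA) => // x Ux.
    by have := uA x Ux; rewrite unitmxE unitfE.
  apply: smooth_onM => //; first exact: smooth_on_cst.
  apply: smooth_det => k l.
  by apply: smooth_on_eq (sA (lift j k) (lift i l)) => x _; rewrite !mxE.
by apply=> x Ux; rewrite /invmx uA // !mxE.
Qed.

End SmoothMx.

(** * Covariance and concentration matrices of the model *)

Section Model.
Context {R : realType} (m : nat) (E : {set 'I_m * 'I_m}).
Local Notation n := (#|E| + (m + m))%N.
Implicit Types (x : 'rV[R]_n).

Definition noise_var x : 'rV[R]_m := lsubmx (rsubmx x).

Lemma smooth_Lambda U : open U -> smooth_mx U (@Lambda_of R m E).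
Proof.
move=> oU i j.
have /smooth_on_eq : smooth_on U (fun x => \sum_(k < #|E|) x 0 (lshift _ k) *
    (delta_mx (enum_val k).1 (enum_val k).2 : 'M[R]_m) i j).
  apply: smooth_on_sum => k _.
  by apply: smooth_onM => //; [exact: smooth_on_coord|exact: smooth_on_cst].
apply=> x _; rewrite /Lambda_of summxE; apply: eq_bigr => k _.
by rewrite !mxE.
Qed.

Lemma smooth_noise_var U i : smooth_on U (fun x => noise_var x 0 i).
Proof.
apply: smooth_on_eq (smooth_on_coord _ (rshift _ (lshift _ i))) => x _.
by rewrite !mxE.
Qed.

Lemma smooth_delta U : smooth_mx U (@delta_of R m E).
Proof.
move=> i j; apply: smooth_on_eq (smooth_on_coord _ (rshift _ (rshift _ i))) => x _.
by rewrite !mxE (ord1 j).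
Qed.

Context (topE : topological_order E).

(** In a topological order [Lambda] is strictly triangular, so [1 - Lambda] has
    determinant 1. *)
Lemma unit_1sub_Lambda x : 1%:M - Lambda_of x \in unitmx.
Proof.
rewrite -unitmx_tr unitmxE det_trig.
  rewrite big1 ?unitr1 // => i _; rewrite !mxE eqxx (RE_Lambda_of x) ?subr0 //.
  by apply/negP => /topE; rewrite ltnn.
apply/is_trig_mxP => i j ij; rewrite !mxE (RE_Lambda_of x).
  by rewrite -val_eqE /= gtn_eqF // subr0.
by apply/negP => /topE; rewrite ltnNge (ltnW ij).
Qed.

Lemma Theta_noise_var x : Theta x <-> forall i, 0 < noise_var x 0 i.
Proof.
split=> [[_ [_ xO]] i|xO]; first by have := xO i; rewrite mxE eqxx mulr1n.
split; first exact: RE_Lambda_of.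
split=> [|i]; last by rewrite mxE eqxx mulr1n; exact: xO.
by apply/is_diag_mxP => i j; rewrite mxE -val_eqE => /negPf ->; rewrite mulr0n.
Qed.

Definition cov_loading x : 'cV[R]_m := (invmx (1%:M - Lambda_of x))^T *m delta_of x.

Lemma trmx_1sub (L : 'M[R]_m) : (1%:M - L)^T = 1%:M - L^T.
Proof. by rewrite linearB /= trmx1. Qed.

Lemma phiG_cov_loading x :
  phiG x = SigmaL (Lambda_of x) (Omega_of x) + cov_loading x *m (cov_loading x)^T.
Proof.
rewrite /phiG /phi /SigmaL /cov_loading mulmxDr mulmxDl; congr (_ + _).
by move: (delta_of x) => d; rewrite trmx_mul trmxK -trmx_1sub -trmx_inv !mulmxA.
Qed.

Definition Omega_inv x : 'M[R]_m := diag_mx (\row_i (noise_var x 0 i)^-1).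
Definition signal_noise x : R := ((delta_of x)^T *m Omega_inv x *m delta_of x) 0 0.
Definition conc_loading x : 'cV[R]_m :=
  (1%:M - Lambda_of x) *m (Omega_inv x *m delta_of x).

(** The Sherman-Morrison formula for the inverse of the covariance matrix.  This
    explicit form, rather than [invmx], displays the smoothness in the parameters
    and the rank-one term. *)
Definition concentration x : 'M[R]_m :=
  (1%:M - Lambda_of x) *m Omega_inv x *m (1%:M - Lambda_of x)^T
  - (1 + signal_noise x)^-1 *: (conc_loading x *m (conc_loading x)^T).

Lemma Omega_invK x : Theta x -> Omega_inv x *m Omega_of x = 1%:M.
Proof.
move=> /Theta_noise_var xO; apply/matrixP => i j; have := lt0r_neq0 (xO i).
rewrite mul_diag_mx !mxE => xi.
case: eqP => _; last by rewrite !mulr0n mulr0.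
by rewrite !mulr1n mulVf.
Qed.

Lemma invmx_SigmaL x : Theta x -> invmx (SigmaL (Lambda_of x) (Omega_of x)) =
  (1%:M - Lambda_of x) *m Omega_inv x *m (1%:M - Lambda_of x)^T.
Proof.
move=> xT; set A := 1%:M - Lambda_of x.
have uA : A \in unitmx by exact: unit_1sub_Lambda.
have e : (A *m Omega_inv x *m A^T) *m SigmaL (Lambda_of x) (Omega_of x) = 1%:M.
  rewrite /SigmaL -trmx_1sub -/A !mulmxA.
  rewrite -[_ *m A^T *m invmx A^T]mulmxA mulmxV ?unitmx_tr // mulmx1.
  by rewrite -[_ *m Omega_inv x *m _]mulmxA Omega_invK // mulmx1 mulmxV.
have [_ uS] := mulmx1_unit e.
by rewrite -[RHS]mulmx1 -(mulmxV uS) mulmxA e mul1mx.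
Qed.

Lemma Omega_inv_sym x : (Omega_inv x)^T = Omega_inv x.
Proof. exact: tr_diag_mx. Qed.

Lemma signal_noise_ge0 x : Theta x -> 0 <= signal_noise x.
Proof.
move=> /Theta_noise_var xO; rewrite /signal_noise mxE sumr_ge0 // => i _.
have := xO i; rewrite mul_mx_diag !mxE => xi.
by rewrite mulrAC mulr_ge0 //; [rewrite -expr2 sqr_ge0|rewrite invr_ge0 ltW].
Qed.

Lemma concentration_mul x : Theta x -> concentration x *m phiG x = 1%:M.
Proof.
move=> xT; have q0 := signal_noise_ge0 xT.
rewrite /phiG /phi /concentration /conc_loading -trmx_1sub.
move: (1%:M - Lambda_of x) (unit_1sub_Lambda x) => A uA.
set d := delta_of x; set Oi := Omega_inv x; set O := Omega_of x.
pose inner := Oi - (1 + signal_noise x)^-1 *: (Oi *m d *m (Oi *m d)^T).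
rewrite (_ : A *m Oi *m A^T - _ = A *m inner *m A^T); last first.
  rewrite /inner mulmxBr mulmxBl; congr (_ - _).
  by rewrite -scalemxAr -scalemxAl !trmx_mul !mulmxA.
rewrite !mulmxA -[_ *m A^T *m invmx A^T]mulmxA mulmxV ?unitmx_tr // mulmx1.
rewrite -[A *m _ *m _]mulmxA.
suff -> : inner *m (O + d *m d^T) = 1%:M.
  by rewrite mulmx1 mulmxV.
have qE : d^T *m Oi *m d = (signal_noise x)%:M by rewrite [LHS]mx11_scalar.
have OO : Oi *m O = 1%:M by exact: Omega_invK.
rewrite /inner mulmxBl !mulmxDr OO -!scalemxAl !trmx_mul Omega_inv_sym.
rewrite -scalerDr.
have -> : Oi *m d *m (d^T *m Oi) *m O = Oi *m d *m d^T.
  by rewrite -!mulmxA OO mulmx1.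
have -> : Oi *m d *m (d^T *m Oi) *m (d *m d^T) = signal_noise x *: (Oi *m d *m d^T).
  rewrite !mulmxA -[_ *m d^T *m Oi]mulmxA -[_ *m (d^T *m Oi) *m d]mulmxA qE.
  by rewrite mul_mx_scalar -scalemxAl.
rewrite -[X in X + _ *: _]scale1r -scalerDl scalerA mulVf ?scale1r ?mulmxA ?addrK //.
by rewrite lt0r_neq0 // ltr_pwDl.
Qed.

(** The two matrices are inverse to each other, so finite fibres of the
    covariance force finite fibres of the concentration. *)
Lemma concentration_inj x y : Theta x -> Theta y ->
  concentration x = concentration y -> phiG x = phiG y.
Proof.
move=> /concentration_mul ex /concentration_mul ey exy.
have [uC _] := mulmx1_unit ex.
by rewrite -[LHS]mul1mx -[RHS]mul1mx -(mulVmx uC) -!mulmxA ex exy ey.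
Qed.

Lemma concentration_sym x : (concentration x)^T = concentration x.
Proof.
rewrite /concentration linearB /= linearZ /=.
by rewrite !trmx_mul !trmxK Omega_inv_sym !mulmxA.
Qed.

Lemma phiG_sym x : Theta x -> (phiG x)^T = phiG x.
Proof.
by move=> [_ xO]; rewrite phiG_cov_loading linearD /= SigmaL_sym // trmx_mul trmxK.
Qed.

Section Smooth.
Context (U : set 'rV[R]_n) (oU : open U).

Lemma smooth_1sub : smooth_mx U (fun x => 1%:M - Lambda_of x).
Proof.
apply: smooth_mxD; first exact: smooth_mx_cst.
by apply: smooth_mxN => //; exact: smooth_Lambda.
Qed.

Lemma smooth_Omega : smooth_mx U (@Omega_of R m E).
Proof.
move=> i j; have [->|ij] := eqVneq i j.
  by apply: smooth_on_eq (smooth_noise_var U j) => x _; rewrite !mxE eqxx mulr1n.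
by apply: smooth_on_eq (smooth_on_cst _ 0) => x _; rewrite mxE (negPf ij) mulr0n.
Qed.

Lemma smooth_cov_loading : smooth_mx U cov_loading.
Proof.
apply: smooth_mxM => //; last exact: smooth_delta.
apply: smooth_mxT; apply: smooth_invmx smooth_1sub => // x _.
exact: unit_1sub_Lambda.
Qed.

Lemma smooth_phiG : smooth_mx U (@phiG R m E).
Proof.
have sB : smooth_mx U (fun x => invmx (1%:M - Lambda_of x)).
  by apply: smooth_invmx smooth_1sub => // x _; exact: unit_1sub_Lambda.
apply: smooth_mxM => //; apply: smooth_mxM => //.
  move=> i j; apply: smooth_on_eq (smooth_mxT sB i j) => x _.
  by rewrite -trmx_1sub trmx_inv.
apply: smooth_mxD; first exact: smooth_Omega.
apply: smooth_mxM => //; first exact: smooth_delta.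
by apply: smooth_mxT; exact: smooth_delta.
Qed.

Context (UT : forall x, U x -> Theta x).

Lemma smooth_Omega_inv : smooth_mx U Omega_inv.
Proof.
move=> i j; have [->|ij] := eqVneq i j.
  have /smooth_on_eq : smooth_on U (fun x => (noise_var x 0 j)^-1).
    apply: smooth_onV (smooth_noise_var U j) => // x /UT/Theta_noise_var xO.
    by rewrite lt0r_neq0.
  by apply => x _; rewrite !mxE eqxx mulr1n.
by apply: smooth_on_eq (smooth_on_cst _ 0) => x _; rewrite mxE (negPf ij) mulr0n.
Qed.

Lemma smooth_conc_loading : smooth_mx U conc_loading.
Proof.
apply: smooth_mxM => //; first exact: smooth_1sub.
by apply: smooth_mxM => //; [exact: smooth_Omega_inv|exact: smooth_delta].
Qed.

Lemma smooth_concentration : smooth_mx U concentration.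
Proof.
apply: smooth_mxD.
  apply: smooth_mxM => //; last by apply: smooth_mxT; exact: smooth_1sub.
  by apply: smooth_mxM => //; [exact: smooth_1sub|exact: smooth_Omega_inv].
apply: smooth_mxN => //; apply: smooth_mxZ => //.
  apply: smooth_onV => //.
    by move=> x /UT/signal_noise_ge0 q0; rewrite lt0r_neq0 // ltr_pwDl.
  apply: smooth_onD; first exact: smooth_on_cst.
  apply: smooth_mxM => //; last exact: smooth_delta.
  apply: smooth_mxM => //; last exact: smooth_Omega_inv.
  by apply: smooth_mxT; exact: smooth_delta.
apply: smooth_mxM => //; first exact: smooth_conc_loading.
by apply: smooth_mxT; exact: smooth_conc_loading.
Qed.
End Smooth.

End Model.

(** * A region of positive loadings and finite fibres *)

Section Main.
Context {R : realType} (m : nat) (E : {set 'I_m * 'I_m}).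
Local Notation n := (#|E| + (m + m))%N.
Implicit Types (x : 'rV[R]_n).

(** [Lambda = 0], [Omega = 1] and all entries of [delta] equal to 1. *)
Definition base_point : 'rV[R]_n := row_mx 0 (row_mx (const_mx 1) (const_mx 1)).

Lemma Lambda_base : Lambda_of base_point = 0.
Proof.
by apply: big1 => k _; rewrite /base_point row_mxKl mxE scale0r.
Qed.

Lemma noise_var_base : noise_var base_point = const_mx 1.
Proof. by rewrite /noise_var row_mxKr row_mxKl. Qed.

Lemma delta_base : delta_of base_point = const_mx 1.
Proof. by rewrite /delta_of !row_mxKr trmx_const. Qed.

Lemma cov_loading_base : cov_loading base_point = const_mx 1.
Proof.
by rewrite /cov_loading Lambda_base delta_base subr0 invmx1 trmx1 mul1mx.
Qed.

Lemma conc_loading_base : conc_loading base_point = const_mx 1.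
Proof.
rewrite /conc_loading /Omega_inv Lambda_base delta_base noise_var_base subr0 mul1mx.
by apply/colP => i; rewrite mul_diag_mx !mxE invr1 mul1r.
Qed.

Lemma near_pos k (V : set 'rV[R]_n) (f : 'I_k -> 'rV[R]_n -> R) x0 :
  open V -> V x0 ->
  (forall i, smooth_on V (f i)) -> (forall i, 0 < f i x0) ->
  \forall x \near x0, forall i, 0 < f i x.
Proof.
move=> oV Vx0 sf f0.
apply: (@filter_forall _ _ (fun i x => 0 < f i x) (nbhs x0)) => i.
exact: (cvgr_gt _ (smooth_on_continuous oV (sf i) Vx0) _ (f0 i)).
Qed.

Context (topE : topological_order E).

(** Positivity of the loadings is an open condition that holds at the base
    point, and the exceptional algebraic set leaves a nonempty open part of any
    such neighbourhood.  One region serves for covariances and concentrations. *)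
Lemma generic_region : generically_finitely_identifiable R E ->
  exists U : set 'rV[R]_n, [/\ open U, U !=set0, U `<=` @Theta R m E,
    forall x, U x -> forall v, 0 < cov_loading x v 0 /\ 0 < conc_loading x v 0
    & forall x, U x -> finite_set [set y | U y /\ phiG y = phiG x]].
Proof.
move=> [Z [[ps Zps] ZT] fin].
have [p [z [pZ pz]]] : exists (p : mpoly.mpoly n R) (z : 'rV[R]_n),
    (forall x, Z x -> mpoly.meval (x 0) p = 0) /\ mpoly.meval (z 0) p != 0.
  apply: contrapT => np; apply: ZT; apply/seteqP; split => // x _.
  apply/Zps => p pps; apply/eqP/contraT => px; exfalso; apply: np.
  by exists p, x; split=> // y /Zps; apply.
(* The concentration loading is smooth only where Omega is invertible; V
   secures this before positivity is imposed in T. *)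
pose V := [set x : 'rV[R]_n | forall i, 0 < noise_var x 0 i]°.
have oV : open V by exact: open_interior.
have Vx0 : V base_point.
  apply: (near_pos openT (x0 := base_point) I) => i; first exact: smooth_noise_var.
  by rewrite noise_var_base mxE.
have VT x : V x -> Theta x by move=> /interior_subset Vx; apply/Theta_noise_var.
have nV : \forall x \near base_point, V x by exact: open_nbhs_nbhs.
have ng : \forall x \near base_point, forall v, 0 < cov_loading x v 0.
  apply: (near_pos openT (x0 := base_point) I) => v.
    exact: (smooth_cov_loading topE openT).
  by rewrite cov_loading_base mxE.
have nk : \forall x \near base_point, forall v, 0 < conc_loading x v 0.
  apply: (near_pos oV Vx0) => v; first exact: (smooth_conc_loading oV VT).
  by rewrite conc_loading_base mxE.
pose T := [set x : 'rV[R]_n | [/\ V x, forall v, 0 < cov_loading x v 0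
  & forall v, 0 < conc_loading x v 0]]°.
have Tx0 : T base_point by apply: filterS3 nV ng nk.
have oT : open T by exact: open_interior.
have [x1 Tx1 px1] := meval_nonzero_dense oT (ex_intro _ _ Tx0) pz.
exists (T `&` [set x | mpoly.meval (x 0) p != 0]).
have ZU x : mpoly.meval (x 0) p != 0 -> ~ Z x.
  by move=> /eqP px /pZ.
have UT x : T x -> Theta x by move=> /interior_subset [/VT].
split.
- apply: openI => //; rewrite openE => x px.
  have pc := smooth_on_continuous openT (smooth_on_meval p openT) (I : setT x).
  have n0 : nbhs (mpoly.meval (x 0) p) [set t | t != 0].
    by apply: open_nbhs_nbhs; split; first exact: open_neq.
  exact: pc _ n0.
- by exists x1.
- by move=> x [/UT].
- by move=> x [/interior_subset [_ gx kx] _] v.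
move=> x [/UT xT px]; apply: sub_finite_set (fin x xT (ZU x px)).
by move=> y [[/UT yT _] yx].
Qed.

End Main.

(** * Conclusion *)

Lemma outer_mxE (R : pzRingType) m (a : 'cV[R]_m) v w :
  (a *m a^T) v w = a v 0 * a w 0.
Proof. by rewrite mxE big_ord1 mxE. Qed.

Theorem theorem1p4 (R : realType) (m : nat) (E : {set 'I_m * 'I_m})
    (topE : topological_order E)
    (identE : generically_finitely_identifiable R E) :
  ((num_components_without_odd_cycle (compl_graph (Gcon R E)))%:Z
     <= (num_edges (Gcon R E))%:Z - (#|E|)%:Z)
  /\
  ((num_components_without_odd_cycle (compl_graph (Gcov R E)))%:Z
     <= (num_edges (Gcov R E))%:Z - (#|E|)%:Z).
Proof.
have [U [oU U0 UT Upos Ufin]] := generic_region topE identE.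
split.
- suff : (#|E| + (m + m) + num_components_without_odd_cycle (compl_graph (Gcon R E))
      <= m + m + num_edges (Gcon R E))%N by lia.
  apply: (@edge_bound _ _ _ _ U (@concentration R m E)
    (fun x v => conc_loading x v 0 / Num.sqrt (1 + signal_noise x)) (-1)) => //.
  + exact: Gcon_sym.
  + by rewrite oppr_eq0 oner_eq0.
  + move=> x Ux; exact: concentration_sym.
  + exact: smooth_concentration.
  + move=> x v Ux; have [_ k0] := Upos x Ux v.
    rewrite divr_gt0 // sqrtr_gt0 ltr_pwDl //; exact: signal_noise_ge0 (UT _ Ux).
  + move=> x v w Ux vw; rewrite /Gcon vw /= => /asboolPn /contrapT K0.
    have xT := UT _ Ux; have [LE OD] := xT; have q0 := signal_noise_ge0 xT.
    rewrite /concentration -invmx_SigmaL // mxE K0 // add0r.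
    rewrite mxE [in LHS]mxE outer_mxE.
    rewrite mulrACA -invfM -expr2 sqr_sqrtr ?addr_ge0 //.
    by rewrite mulN1r [_^-1 * _]mulrC.
  + move=> x Ux; apply: sub_finite_set (Ufin x Ux) => y [Uy yx]; split=> //.
    by apply: concentration_inj yx => //; exact: UT.
- suff : (#|E| + (m + m) + num_components_without_odd_cycle (compl_graph (Gcov R E))
      <= m + m + num_edges (Gcov R E))%N by lia.
  apply: (@edge_bound _ _ _ _ U (@phiG R m E)
    (fun x v => cov_loading x v 0) 1) => //.
  + exact: Gcov_sym.
  + exact: oner_neq0.
  + move=> x Ux; exact: phiG_sym (UT _ Ux).
  + exact: smooth_phiG.
  + by move=> x v Ux; have [] := Upos x Ux v.
  + move=> x v w Ux vw; rewrite /Gcov vw /= => /asboolPn /contrapT S0.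
    have [LE OD] := UT _ Ux.
    by rewrite phiG_cov_loading mxE S0 // add0r mul1r outer_mxE.
Qed.
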